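(* Let $G=([N],E)$ be a connected undirected graph with graph Laplacian $\mathbf{L}\in\mathbb{R}^{N\times N}$, let $z_1,\dots,z_N\in\mathbb{R}^n$, $\mathbf{z}=\mathrm{col}(z_1,\dots,z_N)\in\mathbb{R}^{Nn}$, and $\bar z=\frac1N\sum_{i=1}^N z_i$. Let $\mathbf{x}(t)=\mathrm{col}(x_1(t),\dots,x_N(t))\in\mathbb{R}^{Nn}$ and $\mathbf{w}(t)=\mathrm{col}(w_1(t),\dots,w_N(t))\in\mathbb{R}^{Nn}$ be the trajectory generated by $$\dot{\mathbf{x}}=-(\mathbf{L}\otimes I_n)\mathbf{x}+\mathbf{w}-(\mathbf{x}-\mathbf{z}),\qquad \dot{\mathbf{w}}=-(\mathbf{L}\otimes I_n)\mathbf{w}+(\mathbf{L}\otimes I_n)(\mathbf{x}-\mathbf{z}),$$ with $\mathbf{w}(0)=0$. Then, for any arbitrary starting point $\mathbf{x}(0)\in\mathbb{R}^{Nn}$, the trajectory converges exponentially, with $$\lim_{t\to\infty}x_i(t)=\bar z\qquad\text{and}\qquad\lim_{t\to\infty}w_i(t)=\bar z-z_i\qquad\text{for all } i\in[N].$$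
   Context: $[N]=\{1,\dots,N\}$. $\mathrm{col}(\cdot)$ denotes vertical concatenation of vectors, $\otimes$ the Kronecker product, and $I_n$ the $n\times n$ identity matrix. The graph Laplacian is the standard unweighted one, $(\mathbf{L}y)_i=\sum_{j:\{i,j\}\in E}(y_i-y_j)$. *)

(* Defs.v *)
From HB Require Import structures.
From mathcomp Require Import all_boot all_order all_algebra.
From mathcomp Require Export mxtens.
From mathcomp Require Import all_classical all_reals all_analysis.

Set Implicit Arguments.
Unset Strict Implicit.
Unset Printing Implicit Defensive.

Import Order.TTheory GRing.Theory Num.Theory.
Import numFieldNormedType.Exports.

Local Open Scope classical_set_scope.
Local Open Scope ring_scope.

(* Degree matrix minus adjacency matrix, the graph being given by its adjacency
   relation e. *)
Definition laplacian (R : realType) (N : nat) (e : rel 'I_N) : 'M[R]_N :=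
  \matrix_(i, j) (#|[pred k | e i k]|%:R *+ (i == j) - (e i j)%:R).

Lemma laplacianE (R : realType) (N : nat) (e : rel 'I_N) (y : 'cV[R]_N) i :
  (laplacian R e *m y) i 0 = \sum_(j | e i j) (y i 0 - y j 0).
Proof.
rewrite mxE big_split /= sumr_const sumrN; under eq_bigr do rewrite mxE mulrBl.
rewrite big_split /= sumrN; congr (_ - _).
  rewrite (bigD1 i) //= eqxx mulr1n big1 ?addr0 ?mulr_natl // => j ji.
  by rewrite eq_sym (negbTE ji) mulr0n mul0r.
by rewrite [RHS]big_mkcond; apply: eq_bigr => j _; case: e; rewrite ?mul1r ?mul0r.
Qed.

(* mxtens_index (i, k) has value i * n + k, so block i of a vector of size
   N * n is its i-th group of n consecutive entries, which is the ordering under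
   which A *t 1%:M acts blockwise by A. *)
Definition vcat (R : realType) (N n : nat) (z : 'I_N -> 'cV[R]_n)
    : 'cV[R]_(N * n) :=
  \col_j z (mxtens_unindex j).1 (mxtens_unindex j).2 0.

Definition vblock (R : realType) (N n : nat) (i : 'I_N) (v : 'cV[R]_(N * n))
    : 'cV[R]_n :=
  \col_k v (mxtens_index (i, k)) 0.

Lemma vcatK (R : realType) (N n : nat) (z : 'I_N -> 'cV[R]_n) i :
  vblock i (vcat z) = z i.
Proof. by apply/colP => k; rewrite !mxE mxtens_indexK. Qed.

Lemma vblockK (R : realType) (N n : nat) (v : 'cV[R]_(N * n)) :
  vcat (fun i => vblock i v) = v.
Proof.
by apply/colP => k; rewrite !mxE -surjective_pairing mxtens_unindexK.
Qed.

Definition mean (R : realType) (N n : nat) (z : 'I_N -> 'cV[R]_n) : 'cV[R]_n :=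
  N%:R^-1 *: \sum_i z i.

(* Classical solution on the closed half-line [0, +oo[: nothing is assumed at
   negative times, and at t = 0 only continuity from the right. *)
Definition is_trajectory (R : realType) (N n : nat) (L : 'M[R]_N)
    (z : 'I_N -> 'cV[R]_n) (x w : R -> 'cV[R]_(N * n)) : Prop :=
  [/\ {within `[0, +oo[, continuous x},
      {within `[0, +oo[, continuous w},
      forall t : R, 0 < t ->
        is_derive t 1 x
          (- ((L *t 1%:M) *m x t) + w t - (x t - vcat z)) &
      forall t : R, 0 < t ->
        is_derive t 1 w
          (- ((L *t 1%:M) *m w t) + (L *t 1%:M) *m (x t - vcat z))].

(* On matrices and pairs the library norm is the max norm, equivalent to the
   Euclidean one; only the constant C depends on this choice. *)
Definition cvg_exponentially (R : realType) (V : normedModType R)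
    (f : R -> V) (l : V) : Prop :=
  exists C rate : R, 0 < rate /\
    forall t : R, 0 <= t -> `|f t - l| <= C * expR (- (rate * t)).

(* Main.v *)
Require Import Defs.
From HB Require Import structures.
From mathcomp Require Import all_boot all_order all_algebra.
From mathcomp Require Import all_classical all_reals all_analysis.

From mathcomp Require Import ring lra.

Set Implicit Arguments.
Unset Strict Implicit.
Unset Printing Implicit Defensive.

Import Order.TTheory GRing.Theory Num.Theory.
Import numFieldNormedType.Exports.

Local Open Scope classical_set_scope.
Local Open Scope ring_scope.

(** Subtract the claimed limits: u = x - zbar and v = w - (zbar - z). As the
    Laplacian kills constant vectors, the errors solve the homogeneous system
      u' = - L u - u + v,    v' = L (u - v),
    where L acts on each of the n coordinates separately, so that it suffices
    to study one coordinate, with u and v in R^N. There the entries of v sum to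
    a conserved quantity, which is 0 because w starts at 0; this is the only
    place where the initial value of w matters.

    The natural energy u.Lu + |v|^2 satisfies
      (u.Lu + |v|^2)' = - 2 (|Lu|^2 + (u - v).L(u - v)),
    the cross terms fitting together into the last quadratic form. For v of sum
    zero the right-hand side controls |v|^2 ([dissipation_ge]): up to constants
    Lu controls the centered part p of u, (u - v).L(u - v) controls p - v, and
    v = p - (p - v). Since u.Lu does not see the mean of u, the Lyapunov
    function is [energy] = K (u.Lu + |v|^2) + |u|^2: the damping term - u in
    the equation of u makes |u|^2 decrease up to |v|^2, which a large K absorbs.
    Hence the energy E satisfies E' <= - r E with r = 1 / (1 + K)
    ([energy_dissipation]), and it dominates |u|^2 + |v|^2.

    What is used of the graph is a Poincare inequality mu |y|^2 <= y.Ly for y of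
    sum zero ([poincare]). It is obtained without spectral theory: along a path
    of at most N edges, differences of y are bounded by N times the square root
    of the Dirichlet energy, and for sum zero the squared differences add up to
    2 N |y|^2. *)

(** * The dot product and its derivative *)

Definition dot (R : realType) (N : nat) (a b : 'cV[R]_N) : R :=
  \sum_i a i 0 * b i 0.

Section Dot.
Context {R : realType} {N : nat}.
Implicit Types (a b c : 'cV[R]_N) (A : 'M[R]_N).

Lemma dotC a b : dot a b = dot b a.
Proof. by apply: eq_bigr => i _; rewrite mulrC. Qed.

Lemma dotDl a b c : dot (a + b) c = dot a c + dot b c.
Proof. by rewrite -big_split; apply: eq_bigr => i _; rewrite mxE mulrDl. Qed.

Lemma dotNl a b : dot (- a) b = - dot a b.
Proof. by rewrite -sumrN; apply: eq_bigr => i _; rewrite mxE mulNr. Qed.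

Lemma dotZl (k : R) a b : dot (k *: a) b = k * dot a b.
Proof. by rewrite mulr_sumr; apply: eq_bigr => i _; rewrite mxE mulrA. Qed.

Lemma dotDr a b c : dot a (b + c) = dot a b + dot a c.
Proof. by rewrite dotC dotDl !(dotC a). Qed.

Lemma dotNr a b : dot a (- b) = - dot a b.
Proof. by rewrite dotC dotNl dotC. Qed.

Lemma dotZr (k : R) a b : dot a (k *: b) = k * dot a b.
Proof. by rewrite dotC dotZl dotC. Qed.

Lemma dot_ge0 a : 0 <= dot a a.
Proof. by apply: sumr_ge0 => i _; rewrite -expr2 sqr_ge0. Qed.

Lemma dot_mulmx A a b : dot a (A *m b) = dot (A^T *m a) b.
Proof.
rewrite /dot; under eq_bigr do rewrite mxE mulr_sumr.
rewrite exchange_big; apply: eq_bigr => j _; rewrite mxE mulr_suml.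
by apply: eq_bigr => i _; rewrite mxE mulrCA mulrA.
Qed.

Lemma sqr_coord_le_dot a i : a i 0 ^+ 2 <= dot a a.
Proof.
rewrite /dot (bigD1 i) //= -expr2 lerDl.
by apply: sumr_ge0 => j _; rewrite -expr2 sqr_ge0.
Qed.

Lemma sum_coord_dot a : \sum_i a i 0 = dot (const_mx 1) a.
Proof. by apply: eq_bigr => i _; rewrite mxE mul1r. Qed.

(** Derivatives and continuity are required entrywise, because the curves of
    interest are given by extracting entries of a longer vector. *)
Lemma is_derive_dot (a b : R -> 'cV[R]_N) (a' b' : 'cV[R]_N) (t : R) :
  (forall i, is_derive t 1 (fun s => a s i 0) (a' i 0)) ->
  (forall i, is_derive t 1 (fun s => b s i 0) (b' i 0)) ->
  is_derive t 1 (fun s => dot (a s) (b s)) (dot a' (b t) + dot (a t) b').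
Proof.
move=> da db.
rewrite (_ : (fun s => _) =
    \sum_i (fun s => a s i 0) * (fun s => b s i 0)); last first.
  by apply/funext => s; rewrite fct_sumE; apply: eq_bigr.
apply: is_derive_eq; rewrite /dot -big_split; apply: eq_bigr => i _ /=.
by rewrite /GRing.scale /= addrC (mulrC (b t i 0)).
Qed.

Lemma is_derive_mulmx_coord A (a : R -> 'cV[R]_N) (a' : 'cV[R]_N) (t : R) :
  (forall i, is_derive t 1 (fun s => a s i 0) (a' i 0)) ->
  forall i, is_derive t 1 (fun s => (A *m a s) i 0) ((A *m a') i 0).
Proof.
move=> da i.
rewrite (_ : (fun s => _) = \sum_j A i j *: (fun s => a s j 0)); last first.
  by apply/funext => s; rewrite mxE fct_sumE.
by apply: is_derive_eq; rewrite mxE; apply: eq_bigr.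
Qed.

Lemma continuous_dot {T : topologicalType} (a b : T -> 'cV[R]_N) :
  (forall i, continuous (fun s => a s i 0)) ->
  (forall i, continuous (fun s => b s i 0)) ->
  continuous (fun s => dot (a s) (b s)).
Proof.
move=> ca cb t; apply: cvg_big => [|i _]; first exact: add_continuous.
by apply: cvgM; [exact: ca | exact: cb].
Qed.

Lemma continuous_mulmx_coord {T : topologicalType} A (a : T -> 'cV[R]_N) :
  (forall i, continuous (fun s => a s i 0)) ->
  forall i, continuous (fun s => (A *m a s) i 0).
Proof.
move=> ca i t.
rewrite (_ : (fun s => _) = fun s => \sum_j A i j * a s j 0); last first.
  by apply/funext => s; rewrite mxE.
apply: cvg_big => [|j _]; first exact: add_continuous.
by apply: cvgM; [exact: cvg_cst | exact: ca].
Qed.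

End Dot.

(** * Exponential decay from a differential inequality *)

(** Grönwall: f(t) exp(rt) is nonincreasing. The differential inequality is only
    required for t > 0, continuity takes care of t = 0. *)
Lemma exponential_decay (R : realType) (f df : R -> R) (r : R) :
  {within `[0, +oo[, continuous f} ->
  (forall t : R, 0 < t -> is_derive t 1 f (df t)) ->
  (forall t, 0 < t -> df t <= - r * f t) ->
  forall t, 0 <= t -> f t <= f 0 * expR (- (r * t)).
Proof.
move=> cf derf dfle t t0.
pose g s := f s * expR (r * s).
have dg (s : R) : 0 < s -> is_derive s 1 g ((df s + r * f s) * expR (r * s)).
  move=> s0; have ? := derf _ s0.
  have ? : is_derive s 1 (fun s => expR (r * s)) (r * expR (r * s)).
    have ? : is_derive s 1 ( *%R r) r.
      by apply: (@is_derive_eq _ _ _ (r *: id)); rewrite /GRing.scale /= mulr1.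
    apply: (@is_derive_eq _ _ _ (expR \o *%R r)).
    by rewrite mulrC.
  apply: (@is_derive_eq _ _ _ (f * (fun s => expR (r * s)))).
  by rewrite /GRing.scale /=; ring.
have gle : g t <= g 0.
  apply: (@ler0_derive1_nincry _ g 0) => // [s|s|].
  - by rewrite in_itv /= andbT => /dg [].
  - rewrite in_itv /= andbT => s0; have [_] := dg _ s0.
    rewrite derive1E => ->; rewrite mulr_le0_ge0 ?expR_ge0 //.
    by have := dfle _ s0; lra.
  - move=> s; apply: cvgM; first exact: cf.
    apply: (continuous_subspaceT (f := fun s => expR (r * s))) => y.
    apply: (@continuous_comp _ _ _ ( *%R r) expR).
      exact: mulrl_continuous.
    exact: continuous_expR.
rewrite expRN ler_pdivlMr ?expR_gt0 //.
by move: gle; rewrite /g mulr0 expR0 mulr1.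
Qed.

(** * The energy of the error system *)

Lemma sum_sub_average (R : realType) (N : nat) (f : 'I_N -> R) :
  \sum_i (f i - N%:R^-1 * \sum_j f j) = 0.
Proof.
rewrite big_split /= sumr_const card_ord.
have [N0|N0] := eqVneq N 0%N.
  rewrite big1 ?add0r ?N0 // => i.
  by have := ltn_ord i; rewrite [X in (_ < X)%N]N0.
by rewrite -[X in _ + X]mulr_natl mulrN mulrA mulfV ?pnatr_eq0 // mul1r subrr.
Qed.

Section Energy.
Context {R : realType} {N : nat}.
Variables (L : 'M[R]_N) (mu : R).
Hypotheses (mu_gt0 : 0 < mu) (mu_le1 : mu <= 1).
Hypotheses (L_sym : L^T = L) (L_1 : L *m (const_mx 1 : 'cV[R]_N) = 0).
Hypothesis L_gap : forall y : 'cV[R]_N, \sum_i y i 0 = 0 ->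
  mu * dot y y <= dot y (L *m y).
Implicit Types u v : 'cV[R]_N.

Lemma dotL_sym u v : dot u (L *m v) = dot (L *m u) v.
Proof. by rewrite dot_mulmx L_sym. Qed.

Lemma sum_mulmxL u : \sum_i (L *m u) i 0 = 0.
Proof.
rewrite sum_coord_dot dotL_sym L_1.
by apply: big1 => i _; rewrite mxE mul0r.
Qed.

(** The quadratic form of L only depends on u modulo constants, so that the
    inequality [L_gap] for vectors of sum zero says something about all u. *)
Lemma centering u : exists2 p : 'cV[R]_N,
  \sum_i p i 0 = 0 & L *m p = L *m u.
Proof.
exists (u - (N%:R^-1 * \sum_i u i 0) *: const_mx 1); last first.
  by rewrite mulmxBr -scalemxAr L_1 scaler0 subr0.
by under eq_bigr do rewrite !mxE mulr1; exact: sum_sub_average.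
Qed.

Lemma quadratic_form_congr u v :
  L *m u = L *m v -> dot u (L *m u) = dot v (L *m v).
Proof. by move=> Luv; rewrite [in LHS]Luv dotL_sym Luv dotC. Qed.

Lemma quadratic_form_ge0 u : 0 <= dot u (L *m u).
Proof.
have [p p0 /quadratic_form_congr <-] := centering u.
by apply: le_trans (L_gap p0); rewrite mulr_ge0 ?dot_ge0 // ltW.
Qed.

(** With p the centered part of u and q = p - v, both of sum zero, Cauchy-Schwarz
    and the gap give |Lp| >= mu |p|, and q.Lq >= mu |q|^2 >= mu^2 |q|^2 as
    mu <= 1. Then |v|^2 <= 2 |p|^2 + 2 |q|^2. *)
Lemma dissipation_ge u v : \sum_i v i 0 = 0 ->
  mu ^+ 2 * dot v v <=
  2 * (dot (L *m u) (L *m u) + dot (u - v) (L *m (u - v))).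
Proof.
move=> v0; have [p p0 Lp] := centering u.
have q0 : \sum_i (p - v) i 0 = 0.
  under eq_bigr do rewrite mxE [X in _ + X]mxE.
  by rewrite big_split /= sumrN p0 v0 subr0.
have /quadratic_form_congr -> : L *m (u - v) = L *m (p - v).
  by rewrite !mulmxBr Lp.
rewrite -Lp.
have Lp_ge : mu ^+ 2 * dot p p <= dot (L *m p) (L *m p).
  have gp := ler_wpM2l (ltW mu_gt0) (L_gap p0).
  (* stands for Cauchy-Schwarz, and avoids square roots *)
  have := dot_ge0 (L *m p - mu *: p).
  rewrite !(dotDl, dotDr, dotNl, dotNr, dotZl, dotZr) (dotC (L *m p) p).
  by lra.
have q_ge : mu ^+ 2 * dot (p - v) (p - v) <= dot (p - v) (L *m (p - v)).
  apply: le_trans (L_gap q0); rewrite expr2 -mulrA ler_piMl //.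
  by rewrite mulr_ge0 ?dot_ge0 // ltW.
have v_le : dot v v <= 2 * dot p p + 2 * dot (p - v) (p - v).
  (* 2 |p|^2 + 2 |p - v|^2 - |v|^2 = |2 p - v|^2 *)
  have := dot_ge0 (2 *: p - v).
  rewrite !(dotDl, dotDr, dotNl, dotNr, dotZl, dotZr) (dotC v p).
  by lra.
have := ler_wpM2l (sqr_ge0 mu) v_le.
by lra.
Qed.

(* This weight turns [dissipation_ge] into
   2 |v|^2 <= K (|Lu|^2 + (u - v).L(u - v)). *)
Let K := 4 / mu ^+ 2.

Let K_ge1 : 1 <= K.
Proof.
rewrite ler_pdivlMr ?exprn_gt0 // mul1r.
by have := exprn_ile1 2 (ltW mu_gt0) mu_le1; lra.
Qed.

Definition energy u v : R := K * (dot u (L *m u) + dot v v) + dot u u.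

Lemma energy_ge u v : dot u u + dot v v <= energy u v.
Proof.
rewrite /energy [leLHS]addrC lerD2r -[leLHS]mul1r.
by apply: ler_pM => //; rewrite ?dot_ge0 // lerDr quadratic_form_ge0.
Qed.

(** The left-hand side is the derivative of the energy along the error system,
    see [is_derive_energy]. It is 2 (- K (X + Q) - u.Lu - |u|^2 + u.v) with
    X = |Lu|^2 and Q = (u - v).L(u - v). Half of K (X + Q) pays for |v|^2, the
    other half leaves K X / 2, and u.v <= (|u|^2 + |v|^2) / 2; so it is at most
    - (|u|^2 + |v|^2 + K X). This in turn dominates a multiple of the energy,
    since u.Lu <= (|u|^2 + X) / 2: no bound on the norm of L enters. *)
Lemma energy_dissipation u v : \sum_i v i 0 = 0 ->
  2 * (K * (dot (L *m u) (- (L *m u) - u + v) + dot v (L *m (u - v)))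
       + dot u (- (L *m u) - u + v))
  <= - (1 + K)^-1 * energy u v.
Proof.
move=> v0.
have K_ge1' := K_ge1; have K1_gt0 : 0 < 1 + K by lra.
set X := dot (L *m u) (L *m u); set Q := dot (u - v) (L *m (u - v)).
have X0 : 0 <= X := dot_ge0 _.
have Q0 : 0 <= Q := quadratic_form_ge0 _.
have S0 := quadratic_form_ge0 u.
have -> : dot (L *m u) (- (L *m u) - u + v) + dot v (L *m (u - v)) = - (X + Q).
  rewrite /X /Q !mulmxBr !(dotDl, dotDr, dotNl, dotNr) (dotC (L *m u) v).
  by rewrite (dotL_sym u v) (dotC (L *m u) v) (dotC (L *m u) u); ring.
have V_le : 2 * dot v v <= K * (X + Q).
  have := ler_wpM2l (_ : 0 <= K / 2) (dissipation_ge u v0).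
  rewrite mulrA (_ : K / 2 * mu ^+ 2 = 2) -/X -/Q; last first.
    by rewrite /K; field; rewrite gt_eqF.
  by move=> /(_ ltac:(lra)); lra.
have S_le : 2 * dot u (L *m u) <= dot u u + X.
  have := dot_ge0 (u - L *m u).
  by rewrite !(dotDl, dotDr, dotNl, dotNr) (dotC (L *m u) u) -/X; lra.
have uv_le : 2 * dot u v <= dot u u + dot v v.
  have := dot_ge0 (u - v).
  by rewrite !(dotDl, dotDr, dotNl, dotNr) (dotC v u); lra.
have KQ0 : 0 <= K * Q by rewrite mulr_ge0 //; lra.
have KX0 : 0 <= K * X by rewrite mulr_ge0 //; lra.
have E_le : (1 + K)^-1 * energy u v <= dot u u + dot v v + K * X.
  rewrite ler_pdivrMl // /energy.
  have KS := ler_wpM2l (_ : 0 <= K) S_le.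
  have {}KS := KS ltac:(lra).
  have KKX : 0 <= K * (K * X) by rewrite mulr_ge0 //; lra.
  have KU : 0 <= K * dot u u by rewrite mulr_ge0 ?dot_ge0 //; lra.
  by have := dot_ge0 v; lra.
rewrite !(dotDl, dotDr, dotNl, dotNr).
by have := dot_ge0 v; lra.
Qed.

Lemma is_derive_energy (u v : R -> 'cV[R]_N) (u' v' : 'cV[R]_N) (t : R) :
  (forall i, is_derive t 1 (fun s => u s i 0) (u' i 0)) ->
  (forall i, is_derive t 1 (fun s => v s i 0) (v' i 0)) ->
  is_derive t 1 (fun s => energy (u s) (v s))
    (2 * (K * (dot (L *m u t) u' + dot (v t) v') + dot (u t) u')).
Proof.
move=> du dv.
have ? := is_derive_dot du (is_derive_mulmx_coord L du).
have ? := is_derive_dot du du.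
have ? := is_derive_dot dv dv.
apply: (@is_derive_eq _ _ _ (K *: ((fun s => dot (u s) (L *m u s))
  + (fun s => dot (v s) (v s))) + (fun s => dot (u s) (u s)))).
rewrite /GRing.scale /= (dotL_sym (u t)) (dotC u' (L *m _)) (dotC v') (dotC u').
ring.
Qed.

Lemma continuous_energy {T : topologicalType} (u v : T -> 'cV[R]_N) :
  (forall i, continuous (fun s => u s i 0)) ->
  (forall i, continuous (fun s => v s i 0)) ->
  continuous (fun s => energy (u s) (v s)).
Proof.
move=> cu cv t.
have cLu := continuous_dot (b := fun s => L *m u s) cu
  (continuous_mulmx_coord (A := L) cu).
apply: cvgD; last exact: (continuous_dot cu cu).
apply: cvgM; first exact: cvg_cst.
by apply: cvgD; [exact: cLu | exact: (continuous_dot cv cv)].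
Qed.

Lemma error_decay (u v : R -> 'cV[R]_N) :
  (forall i, {within `[0, +oo[, continuous (fun s => u s i 0)}) ->
  (forall i, {within `[0, +oo[, continuous (fun s => v s i 0)}) ->
  (forall (t : R) i, 0 < t ->
    is_derive t 1 (fun s => u s i 0) ((- (L *m u t) - u t + v t) i 0)) ->
  (forall (t : R) i, 0 < t ->
    is_derive t 1 (fun s => v s i 0) ((L *m (u t - v t)) i 0)) ->
  \sum_i v 0 i 0 = 0 ->
  forall t, 0 <= t ->
    dot (u t) (u t) + dot (v t) (v t) <=
    energy (u 0) (v 0) * expR (- ((1 + K)^-1 * t)).
Proof.
move=> cu cv du dv v0 t t0.
have sum_v s : 0 <= s -> \sum_i v s i 0 = 0.
  move=> s0.
  (* a conserved quantity, seen as one decaying at rate 0, as is its opposite *)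
  have cS (c : R) :
    {within `[0, +oo[, continuous (fun r => c * \sum_i v r i 0)}.
    move=> r; apply: cvgM; first exact: cvg_cst.
    apply: cvg_big => [|i _]; first exact: add_continuous.
    exact: cv.
  have dS (c : R) (r : R) : 0 < r ->
    is_derive r 1 (fun r => c * \sum_i v r i 0) 0.
    move=> r0.
    have ? i := dv _ i r0.
    rewrite (_ : (fun r => _) = c *: \sum_i (fun r => v r i 0)); last first.
      by apply/funext => q; congr (_ * _); rewrite fct_sumE.
    by apply: is_derive_eq; rewrite sum_mulmxL scaler0.
  have S_le (c : R) : c * \sum_i v s i 0 <= 0.
    have := exponential_decay (cS c) (dS c) (r := 0).
    move=> /(_ _ s s0); rewrite v0 mulr0 mul0r; apply => r _.
    by rewrite oppr0 mul0r.
  by apply/eqP; rewrite eq_le; have := S_le 1; have := S_le (-1); lra.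
apply: le_trans (energy_ge _ _) _.
apply: (exponential_decay _
  (fun r r0 => is_derive_energy (du r ^~ r0) (dv r ^~ r0))).
- exact: continuous_energy.
- by move=> r r0; apply: energy_dissipation; apply/sum_v/ltW.
- by [].
Qed.

End Energy.

(** * The graph Laplacian and its Poincare inequality *)

Lemma laplacian_sym (R : realType) (N : nat) (e : rel 'I_N) :
  symmetric e -> (laplacian R e)^T = laplacian R e.
Proof.
move=> e_sym; apply/matrixP => i j; rewrite !mxE e_sym eq_sym.
by have [->|] := eqVneq i j; rewrite ?mulr0n.
Qed.

Lemma laplacian_const (R : realType) (N : nat) (e : rel 'I_N) (c : R) :
  laplacian R e *m (const_mx c : 'cV_N) = 0.
Proof.
apply/colP => i; rewrite laplacianE [RHS]mxE.
by apply: big1 => j _; rewrite !mxE subrr.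
Qed.

Section Poincare.
Context {R : realType} {N : nat} {e : rel 'I_N}.
Hypothesis e_sym : symmetric e.
Hypothesis e_conn : forall i j : 'I_N, connect e i j.
Implicit Type y : 'cV[R]_N.

(** Every edge is counted twice, once in each direction. *)
Definition dirichlet y : R := \sum_i \sum_(j | e i j) (y i 0 - y j 0) ^+ 2.

Lemma dirichlet_ge0 y : 0 <= dirichlet y.
Proof. by do 2!apply: sumr_ge0 => ? _; exact: sqr_ge0. Qed.

Lemma dirichletE y : dirichlet y = 2 * dot y (laplacian R e *m y).
Proof.
pose S := \sum_i \sum_(j | e i j) y i 0 * (y i 0 - y j 0).
have -> : dot y (laplacian R e *m y) = S.
  by apply: eq_bigr => i _; rewrite laplacianE mulr_sumr.
have SE : S = \sum_i \sum_(j | e i j) y j 0 * (y j 0 - y i 0).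
  rewrite /S (exchange_big_dep xpredT) //=; apply: eq_bigr => i _.
  by apply: eq_bigl => j; rewrite e_sym.
rewrite mulrDl !mul1r {2}SE -big_split; apply: eq_bigr => i _ /=.
by rewrite -big_split; apply: eq_bigr => j _ /=; ring.
Qed.

Lemma edge_le_dirichlet y i j :
  e i j -> `|y i 0 - y j 0| <= Num.sqrt (dirichlet y).
Proof.
move=> eij; rewrite -sqrtr_sqr ler_sqrt ?dirichlet_ge0 //.
rewrite /dirichlet (bigD1 i) //= (bigD1 j) //= -addrA lerDl addr_ge0 //.
  by apply: sumr_ge0 => ? _; exact: sqr_ge0.
by do 2!apply: sumr_ge0 => ? _; exact: sqr_ge0.
Qed.

(** Bounding each edge difference by the whole Dirichlet energy, instead of
    adding their squares along the path, costs a power of N but requires nothing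
    of the path. *)
Lemma path_le_dirichlet y i p : path e i p ->
  `|y i 0 - y (last i p) 0| <= (size p)%:R * Num.sqrt (dirichlet y).
Proof.
elim: p i => [|j p IH] i /=; first by rewrite subrr normr0 mul0r.
move=> /andP[/(edge_le_dirichlet y) eij /IH pj].
rewrite -(subrKA (y j 0)) (le_trans (ler_normD _ _)) //.
by rewrite -natr1 mulrDl mul1r addrC lerD.
Qed.

Lemma gap_le_dirichlet y i j :
  (y i 0 - y j 0) ^+ 2 <= N%:R ^+ 2 * dirichlet y.
Proof.
have /connectP[p0 /shortenP[p pe pu _] ->] := e_conn i j.
have sp : (size p <= N)%N.
  by have := max_card [in i :: p]; rewrite (card_uniqP pu) card_ord => /ltnW.
rewrite -[X in _ * X]sqr_sqrtr ?dirichlet_ge0 // -exprMn.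
rewrite -real_normK ?num_real //.
rewrite lerXn2r ?nnegrE ?mulr_ge0 ?sqrtr_ge0 //.
rewrite (le_trans (path_le_dirichlet y pe)) //.
by rewrite ler_wpM2r ?sqrtr_ge0 // ler_nat.
Qed.

(** The sum of (y_i - y_j)^2 over all i and j is 2 N |y|^2 for y of sum zero, and
    at most N^2 N^2 times the Dirichlet energy. The constant uses N + 1 rather
    than N so as to be positive and at most 1 for the empty graph too. *)
Lemma poincare y : \sum_i y i 0 = 0 ->
  (N.+1%:R ^+ 3)^-1 * dot y y <= dot y (laplacian R e *m y).
Proof.
move=> y0; rewrite ler_pdivrMl ?exprn_gt0 //.
have [N0|N_gt0] := posnP N.
  rewrite /dot !big1 ?mulr0 // => i;
    by have := ltn_ord i; rewrite [X in (_ < X)%N]N0.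
have N_gt0R : 0 < N%:R :> R by rewrite ltr0n.
have q0 : 0 <= dot y (laplacian R e *m y).
  by have := dirichlet_ge0 y; rewrite dirichletE pmulr_rge0.
have sqE : \sum_i \sum_j (y i 0 - y j 0) ^+ 2 = 2 * (N%:R * dot y y).
  have rowE i : \sum_j (y i 0 - y j 0) ^+ 2 = N%:R * y i 0 ^+ 2 + dot y y.
    under eq_bigr do rewrite sqrrB.
    rewrite !big_split /= sumrN sumr_const card_ord.
    rewrite -[X in X - _]mulr_natl sumrMnl.
    rewrite -mulr_sumr y0 mulr0 mul0rn subr0.
    by congr (_ + _); apply: eq_bigr => j _; rewrite expr2.
  rewrite (eq_bigr _ (fun i _ => rowE i)) big_split /= -mulr_sumr.
  rewrite sumr_const card_ord -[X in _ + X]mulr_natl.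
  rewrite [X in _ * X + _](_ : _ = dot y y); last first.
    by apply: eq_bigr => i _; rewrite expr2.
  by ring.
have : N%:R * dot y y <= N%:R * (N%:R ^+ 3 * dot y (laplacian R e *m y)).
  have : \sum_(i < N) \sum_(j < N) (y i 0 - y j 0) ^+ 2 <=
         \sum_(i < N) \sum_(j < N) N%:R ^+ 2 * dirichlet y.
    by do 2!apply: ler_sum => ? _; exact: gap_le_dirichlet.
  rewrite sqE !sumr_const !card_ord -mulrnA -[leRHS]mulr_natl natrM dirichletE.
  by lra.
rewrite ler_pM2l // => /le_trans; apply; apply: ler_wpM2r => //.
by rewrite lerXn2r ?nnegrE // ler_nat.
Qed.

End Poincare.

(** * Coordinates of stacked vectors *)

(** The k-th coordinates of all agents: the subspaces on which the Kronecker
    product of L with the identity acts as L. *)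
Definition slice (R : realType) (N n : nat) (k : 'I_n)
    (y : 'cV[R]_(N * n)) : 'cV[R]_N :=
  \col_i y (mxtens_index (i, k)) 0.

Section Slice.
Context {R : realType} {N n : nat}.
Implicit Types (k : 'I_n) (y : 'cV[R]_(N * n)).

Lemma sliceD k : {morph @slice R N n k : y1 y2 / y1 + y2}.
Proof. by move=> y1 y2; apply/colP => i; rewrite !mxE. Qed.

Lemma sliceN k : {morph @slice R N n k : y / - y}.
Proof. by move=> y; apply/colP => i; rewrite !mxE. Qed.

Lemma slice_tens (L : 'M[R]_N) k y :
  slice k ((L *t 1%:M) *m y) = L *m slice k y.
Proof.
apply/colP => i; rewrite !mxE.
rewrite (reindex (@mxtens_index N n)) /=; last first.
  exact/onW_bij/(Bijective (@mxtens_indexK N n) (@mxtens_unindexK N n)).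
transitivity (\sum_p L i p.1 * (k == p.2)%:R * slice p.2 y p.1 0).
  by apply: eq_bigr => -[a b] _; rewrite tensmxE !mxE.
rewrite -(pair_bigA _ (fun a b => L i a * (k == b)%:R * slice b y a 0)) /=.
apply: eq_bigr => a _; rewrite (bigD1 k) //= big1 => [|b bk].
  by rewrite addr0 eqxx mulr1.
by rewrite eq_sym (negbTE bk) mulr0 mul0r.
Qed.

Lemma slice_vcat k (z : 'I_N -> 'cV[R]_n) : slice k (vcat z) = \col_i z i k 0.
Proof. by apply/colP => i; rewrite !mxE mxtens_indexK. Qed.

Lemma mulmx_slice_vcat_const (L : 'M[R]_N) k (c : 'cV[R]_n) :
  (forall a, L *m (const_mx a : 'cV[R]_N) = 0) ->
  L *m slice k (vcat (fun=> c)) = 0.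
Proof.
move=> L_const.
rewrite slice_vcat (_ : \col_i _ = const_mx (c k 0)) ?L_const //.
by apply/colP => i; rewrite !mxE.
Qed.

Lemma norm_le_slices y (B : R) : 0 <= B ->
  (forall k i, `|slice k y i 0| <= B) -> `|y| <= B.
Proof.
move=> B0 yB; rewrite /Num.Def.normr /= mx_normrE.
apply: bigmax_le => // -[a b] _ /=; rewrite (ord1 b).
by have := yB (mxtens_unindex a).2 (mxtens_unindex a).1;
  rewrite mxE -surjective_pairing mxtens_unindexK.
Qed.

Lemma norm_vblock_le (i : 'I_N) y : `|vblock i y| <= `|y|.
Proof.
rewrite /Num.Def.normr /= !mx_normrE.
apply: bigmax_le => [|[k ?] _ /=]; first exact: bigmax_ge_id.
by rewrite mxE; exact: (le_bigmax _ _ (mxtens_index (i, k), 0)).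
Qed.

Lemma vblockB (i : 'I_N) (y1 y2 : 'cV[R]_(N * n)) :
  vblock i (y1 - y2) = vblock i y1 - vblock i y2.
Proof. by apply/colP => k; rewrite !mxE. Qed.

End Slice.

(** * Calculus of coordinates *)

Lemma is_derive_coord (R : realType) (m n : nat) (M : R -> 'M[R]_(m, n))
    (M' : 'M[R]_(m, n)) (t : R) i j :
  is_derive t 1 M M' -> is_derive t 1 (fun s => M s i j) (M' i j).
Proof.
move=> [dM <-]; rewrite derive_mx // mxE.
by apply/derivableP; move/derivable_mxP: dM; exact.
Qed.

Lemma continuous_coord_within (R : realType) (A : set R) (m n : nat)
    (M : R -> 'M[R]_(m, n)) i j :
  {within A, continuous M} -> {within A, continuous (fun s => M s i j)}.
Proof.
move=> cM t.
exact: (continuous_comp (cM t) (coord_continuous (i := i) (j := j) (x := M t))).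
Qed.

Lemma within_continuous_slice (R : realType) (N n : nat) (A : set R)
    (k : 'I_n) (y : R -> 'cV[R]_(N * n)) (c : 'cV[R]_(N * n)) i :
  {within A, continuous y} ->
  {within A, continuous (fun s => slice k (y s - c) i 0)}.
Proof.
move=> cy.
rewrite (_ : (fun s => _) = fun s => (y s - c) (mxtens_index (i, k)) 0).
  apply: (continuous_coord_within (M := fun s => y s - c)).
  by move=> s; apply: cvgB; [exact: cy | exact: cvg_cst].
by apply/funext => s; rewrite mxE.
Qed.

Lemma is_derive_slice (R : realType) (N n : nat) (k : 'I_n)
    (y : R -> 'cV[R]_(N * n)) (y' c : 'cV[R]_(N * n)) (t : R) i :
  is_derive t 1 y y' ->
  is_derive t 1 (fun s => slice k (y s - c) i 0) (slice k y' i 0).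
Proof.
move=> dy.
have dyc : is_derive t 1 (y - cst c) y'.
  by apply: is_derive_eq; rewrite subr0.
rewrite [slice k y' i 0]mxE.
rewrite (_ : (fun s => _) = fun s => (y - cst c) s (mxtens_index (i, k)) 0).
  exact: is_derive_coord.
by apply/funext => s; rewrite mxE.
Qed.

(** * Exponential convergence *)

Lemma cvg_exponentially_contraction (R : realType) (V W : normedModType R)
    (f : R -> V) (l : V) (g : R -> W) (m : W) :
  (forall t, `|g t - m| <= `|f t - l|) ->
  cvg_exponentially f l -> cvg_exponentially g m.
Proof.
move=> gf [C [r [r0 fl]]]; exists C, r; split=> // t t0.
exact: le_trans (fl t t0).
Qed.

Lemma cvg_exponentially_cvg (R : realType) (V : normedModType R)
    (f : R -> V) (l : V) : cvg_exponentially f l -> f t @[t --> +oo] --> l.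
Proof.
move=> [C [r [r0 fl]]]; apply/cvgrPdist_le => eps eps0.
have : C * expR (- (r * t)) @[t --> +oo] --> C * 0.
  apply: cvgM; first exact: cvg_cst.
  apply: (@cvg_comp _ _ _ (fun t => r * t) (fun s => expR (- s))).
    exact/gt0_cvgMry.
  exact: cvgr_expR.
rewrite mulr0 => /cvgr_dist_le /(_ _ eps0) small.
near=> t; rewrite distrC; apply: le_trans (fl t _) _.
  by near: t; apply: nbhs_pinfty_ge; exact: num_real.
apply: le_trans (ler_norm _) _; rewrite -normrN -sub0r.
by near: t.
Unshelve. all: by end_near. Qed.

(** * Trajectories *)

(** The rate r does not depend on the coordinate k, which is what allows the
    coordinates to be put together. *)
Lemma trajectory_energy_decay (R : realType) (N n : nat) (L : 'M[R]_N) (mu : R)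
    (z : 'I_N -> 'cV[R]_n) (x w : R -> 'cV[R]_(N * n)) :
  0 < mu -> mu <= 1 -> L^T = L ->
  (forall c, L *m (const_mx c : 'cV[R]_N) = 0) ->
  (forall y : 'cV[R]_N, \sum_i y i 0 = 0 -> mu * dot y y <= dot y (L *m y)) ->
  is_trajectory L z x w -> w 0 = 0 ->
  exists2 r : R, 0 < r & forall k : 'I_n, exists E : R, forall t, 0 <= t ->
    let u := slice k (x t - vcat (fun=> mean z)) in
    let v := slice k (w t - vcat (fun i => mean z - z i)) in
    dot u u + dot v v <= E * expR (- (r * t)).
Proof.
move=> mu0 mu1 L_sym L_const L_gap [cx cw dx dw] w0.
set C := vcat (fun=> mean z); set D := vcat (fun i => mean z - z i).
have DE : D = C - vcat z by apply/colP => i; rewrite !mxE.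
have r_gt0 : 0 < (1 + 4 / mu ^+ 2)^-1.
  by rewrite invr_gt0 addr_gt0 // divr_gt0 // exprn_gt0.
exists (1 + 4 / mu ^+ 2)^-1 => // k.
have LC : L *m slice k C = 0 by exact: mulmx_slice_vcat_const.
pose u t := slice k (x t - C); pose v t := slice k (w t - D).
exists (energy L mu (u 0) (v 0)) => t t0 /=.
apply: (error_decay mu0 mu1 L_sym (L_const 1) L_gap (u := u) (v := v)) => //.
- by move=> i; exact: within_continuous_slice.
- by move=> i; exact: within_continuous_slice.
- move=> s i s0.
  apply: (is_derive_eq (is_derive_slice k C i (dx _ s0))).
  congr (fun M : 'cV[R]_N => M i 0).
  rewrite /u /v DE !(sliceD, sliceN) slice_tens mulmxBr LC subr0.
  by apply/colP => j; move: (L *m _) => Lx; rewrite !mxE; ring.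
- move=> s i s0.
  apply: (is_derive_eq (is_derive_slice k D i (dw _ s0))).
  congr (fun M : 'cV[R]_N => M i 0).
  rewrite sliceD sliceN !slice_tens -mulmxN -mulmxDr; congr (_ *m _).
  by rewrite /u /v DE !(sliceD, sliceN); apply/colP => j; rewrite !mxE; ring.
- under eq_bigr do rewrite mxE w0 !mxE mxtens_indexK /=.
  (* w starts at 0, so that v starts at z - zbar *)
  rewrite summxE -[RHS](sum_sub_average (fun i => z i k 0)).
  by apply: eq_bigr => i _; rewrite sub0r opprB.
Qed.

Theorem theorem1 (R : realType) (N n : nat)
  (e : rel 'I_N) (e_sym : symmetric e) (e_irr : irreflexive e)
  (e_conn : forall i j : 'I_N, connect e i j)
  (z : 'I_N -> 'cV[R]_n) (x0 : 'cV[R]_(N * n))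
  (x w : R -> 'cV[R]_(N * n))
  (traj : is_trajectory (laplacian R e) z x w)
  (x_init : x 0 = x0) (w_init : w 0 = 0) :
  [/\ cvg_exponentially (fun t : R => (x t, w t))
        (vcat (fun=> mean z), vcat (fun i => mean z - z i)),
      forall i : 'I_N, vblock i (x t) @[t --> +oo] --> mean z &
      forall i : 'I_N, vblock i (w t) @[t --> +oo] --> mean z - z i].
Proof.
set C := vcat _; set D := vcat _.
have mu_gt0 : 0 < (N.+1%:R ^+ 3)^-1 :> R by rewrite invr_gt0 exprn_gt0.
have mu_le1 : (N.+1%:R ^+ 3)^-1 <= 1 :> R.
  by rewrite invf_le1 ?exprn_gt0 // exprn_ege1 // ler1n.
have [r r0 /choice[E bound]] := trajectory_energy_decay mu_gt0 mu_le1
  (laplacian_sym R e_sym) (laplacian_const e) (poincare e_sym e_conn)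
  traj w_init.
have E_ge0 k : 0 <= E k.
  have := bound k 0 (lexx _); rewrite mulr0 oppr0 expR0 mulr1.
  by apply: le_trans; rewrite addr_ge0 ?dot_ge0.
pose B := \sum_k Num.sqrt (E k).
have B_ge0 : 0 <= B by apply: sumr_ge0 => k _; exact: sqrtr_ge0.
(* the energy bounds squares, hence the square roots and the halved rate *)
have coord_le k (t : R) (y : 'cV[R]_N) i :
    dot y y <= E k * expR (- (r * t)) -> `|y i 0| <= B * expR (- (r / 2 * t)).
  move=> yE.
  apply: (@le_trans _ _ (Num.sqrt (E k) * expR (- (r / 2 * t)))).
    rewrite -ler_sqr ?nnegrE ?mulr_ge0 ?sqrtr_ge0 ?expR_ge0 //.
    rewrite real_normK ?num_real // exprMn sqr_sqrtr // -expRM_natl.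
    rewrite (_ : 2%:R * _ = - (r * t)); last by field.
    exact: le_trans (sqr_coord_le_dot y i) yE.
  rewrite ler_wpM2r ?expR_ge0 // /B (bigD1 k) //= lerDl.
  by apply: sumr_ge0 => ? _; exact: sqrtr_ge0.
have cvg_xw : cvg_exponentially (fun t : R => (x t, w t)) (C, D).
  exists B, (r / 2); split=> [|t t0]; first by rewrite divr_gt0.
  have B0 : 0 <= B * expR (- (r / 2 * t)) by rewrite mulr_ge0 ?expR_ge0.
  rewrite prod_normE /= ge_max; apply/andP; split.
    apply: norm_le_slices => // k i; apply: (coord_le k).
    by apply: le_trans (bound k t t0); rewrite lerDl dot_ge0.
  apply: norm_le_slices => // k i; apply: (coord_le k).
  by apply: le_trans (bound k t t0); rewrite lerDr dot_ge0.
split=> // i.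
  apply: cvg_exponentially_cvg.
  apply: cvg_exponentially_contraction cvg_xw => t.
  rewrite -[X in _ - X](vcatK (fun=> mean z) i) -vblockB.
  apply: le_trans (norm_vblock_le _ _) _.
  by rewrite prod_normE /= le_max lexx.
apply: cvg_exponentially_cvg.
apply: cvg_exponentially_contraction cvg_xw => t.
rewrite -[X in _ - X](vcatK (fun i => mean z - z i) i) -vblockB.
apply: le_trans (norm_vblock_le _ _) _.
by rewrite prod_normE /= le_max lexx orbT.
Qed.
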